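(* Let $q$ be an even prime power and let $L$ be a line of $\mathrm{PG}(5,q)$ in the $K$-orbit $o_{12,3}$. Then the hyperplane-orbit distribution of $L$ is $OD_4(L)=\left[q+1,\,q^2+\frac q2,\,q^2-\frac q2,\,q^3-q^2\right]$.
   Context: A point $(y_0,\dots,y_5)$ of $\mathrm{PG}(5,q)$ is identified with the nonzero symmetric matrix $\begin{bmatrix} y_0&y_1&y_2\\ y_1&y_3&y_4\\ y_2&y_4&y_5\end{bmatrix}$ up to scalar. $K\cong\mathrm{PGL}(3,q)$ acts by $M\mapsto AMA^T$, $A\in\mathrm{GL}(3,q)$. The orbit $o_{12,3}$ (defined only for $q$ even) is the $K$-orbit of the line $\left\{\begin{bmatrix} 0&x&0\\ x&x+y&y\\ 0&y&0\end{bmatrix}:(x,y)\in\mathrm{PG}(1,q)\right\}$. Hyperplanes correspond to conics of $\mathrm{PG}(2,q)$ (nonzero quadratic forms up to scalar): $\sum_{0\le i\le j\le2}a_{ij}X_iX_j$ corresponds to $a_{00}Y_0+a_{01}Y_1+a_{02}Y_2+a_{11}Y_3+a_{12}Y_4+a_{22}Y_5=0$. $\mathcal H_1,\mathcal H_{2,r},\mathcal H_{2,i},\mathcal H_3$ are the sets of hyperplanes corresponding respectively to double lines (scalar multiples of squares of linear forms), pairs of distinct real lines (products of two non-proportional linear forms over $\mathbb F_q$), pairs of conjugate imaginary lines (scalar multiples of products of two non-proportional linear forms conjugate over $\mathbb F_{q^2}$), and non-singular conics (those with $4a_{00}a_{11}a_{22}+a_{01}a_{02}a_{12}-a_{00}a_{12}^2-a_{11}a_{02}^2-a_{22}a_{01}^2\ne0$).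 $OD_4(L)=[h_1,h_{2,r},h_{2,i},h_3]$ lists the numbers of hyperplanes in $\mathcal H_1,\mathcal H_{2,r},\mathcal H_{2,i},\mathcal H_3$ containing $L$. *)

(* Defs.v *)
From mathcomp Require Import all_boot all_order all_fingroup all_algebra.
From mathcomp Require Import mpoly.

Set Implicit Arguments.
Unset Strict Implicit.
Unset Printing Implicit Defensive.

Import GRing.Theory.
Local Open Scope ring_scope.

Section PG5.
Variable F : finFieldType.
Implicit Types (M A a : 'M[F]_3).

(* A point of PG(5,q): the set of all nonzero scalar multiples of a nonzero   *)
(* symmetric matrix M.  The coordinates are y0 = M 0 0, y1 = M 0 1,           *)
(* y2 = M 0 2, y3 = M 1 1, y4 = M 1 2, y5 = M 2 2.                            *)
Definition pt M : {set 'M[F]_3} := [set c *: M | c in [pred c : F | c != 0]].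

Definition symmx (y0 y1 y2 y3 y4 y5 : F) : 'M[F]_3 :=
  \matrix_(i < 3, j < 3)
    nth 0 (nth [::] [:: [:: y0; y1; y2];
                        [:: y1; y3; y4];
                        [:: y2; y4; y5]] i) j.

Definition K_point A (p : {set 'M[F]_3}) : {set 'M[F]_3} :=
  [set A *m M *m A^T | M in p].

(* Lines and hyperplanes of PG(5,q) are sets of points. *)
Definition K_line A (L : {set {set 'M[F]_3}}) : {set {set 'M[F]_3}} :=
  [set K_point A p | p in L].

Definition line_o12_3 : {set {set 'M[F]_3}} :=
  [set pt (symmx 0 xy.1 0 (xy.1 + xy.2) xy.2 0)
     | xy in [pred xy : F * F | xy != (0, 0)]].

Definition o12_3 : {set {set {set 'M[F]_3}}} :=
  [set K_line A line_o12_3 | A in [pred A : 'M[F]_3 | A \in unitmx]].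

(* Only the entries a i j with i <= j matter in qform a and hyperplane a. *)
Definition hyperplane a : {set {set 'M[F]_3}} :=
  [set pt M | M in [pred M : 'M[F]_3 |
     [&& M^T == M, M != 0
       & \sum_(i < 3) \sum_(j < 3 | (i <= j)%N) a i j * M i j == 0]]].

Definition qform a : {mpoly F[3]} :=
  \sum_(i < 3) \sum_(j < 3 | (i <= j)%N) a i j *: ('X_i * 'X_j).

End PG5.

Definition lform (R : comNzRingType) (l : 'rV[R]_3) : {mpoly R[3]} :=
  \sum_(i < 3) l 0 i *: 'X_i.

Definition proportional (R : finFieldType) (l m : 'rV[R]_3) : bool :=
  [exists c : R, l == c *: m] || [exists c : R, m == c *: l].

Section Conics.
Variable F : finFieldType.
Implicit Type a : 'M[F]_3.

Definition double_line a : bool :=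
  (qform a != 0)
  && [exists c : F, exists l : 'rV[F]_3, qform a == c *: lform l ^+ 2].

Definition real_line_pair a : bool :=
  [exists l : 'rV[F]_3, exists m : 'rV[F]_3,
     ~~ proportional l m && (qform a == lform l * lform m)].

(* E is a field with q^2 elements containing F via iota; conjugation of E     *)
(* over F is x |-> x ^+ q.                                                    *)
Definition imaginary_line_pair (E : finFieldType) (iota : {rmorphism F -> E}) a
    : bool :=
  (qform a != 0)
  && [exists c : F, exists l : 'rV[E]_3,
       let lbar := map_mx (fun x : E => x ^+ #|F|) l in
       ~~ proportional l lbar
       && (map_mpoly iota (qform a) == iota c *: (lform l * lform lbar))].

Definition nonsingular_conic a : bool :=
  4%:R * a 0 0 * a 1 1 * a 2%:R 2%:R + a 0 1 * a 0 2%:R * a 1 2%:R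
  - a 0 0 * a 1 2%:R ^+ 2 - a 1 1 * a 0 2%:R ^+ 2 - a 2%:R 2%:R * a 0 1 ^+ 2
  != 0.

Definition H1 : {set {set {set 'M[F]_3}}} :=
  [set hyperplane a | a in double_line].
Definition H2r : {set {set {set 'M[F]_3}}} :=
  [set hyperplane a | a in real_line_pair].
Definition H2i (E : finFieldType) (iota : {rmorphism F -> E})
    : {set {set {set 'M[F]_3}}} :=
  [set hyperplane a | a in imaginary_line_pair iota].
Definition H3 : {set {set {set 'M[F]_3}}} :=
  [set hyperplane a | a in nonsingular_conic].

Definition OD4 (E : finFieldType) (iota : {rmorphism F -> E})
    (L : {set {set 'M[F]_3}}) : seq nat :=
  [:: #|[set H in H1 | L \subset H]|;
      #|[set H in H2r | L \subset H]|;
      #|[set H in H2i iota | L \subset H]|;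
      #|[set H in H3 | L \subset H]|].

End Conics.

(* Main.v *)
Require Import Defs.
From mathcomp Require Import all_boot all_order all_fingroup all_algebra.
From mathcomp Require Import all_field.
From mathcomp Require Import mpoly ring zify.

(* The coordinate change M |-> A M A^T turns the count for L into a count for *)
(* the representative line, whose hyperplanes are the conics                  *)
(*   a X0^2 + b X0 X2 + c X2^2 + t (X0 X1 + X1^2 + X1 X2).                    *)
(* Such a conic is singular iff t (t (a + b + c) + b^2) = 0.  A singular one  *)
(* that is not a double line splits over F or over the quadratic extension    *)
(* according to whether an explicit parameter v (a c / b^2 if t = 0, a / t    *)
(* otherwise) lies in the Artin-Schreier set {s^2 + s | s in F}, which has    *)
(* q/2 elements: a factorization amounts to a root s of s^2 + s = v, and      *)
(* swapping (or conjugating) the two factors replaces s by s + 1.             *)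

Set Implicit Arguments.
Unset Strict Implicit.
Unset Printing Implicit Defensive.

Import GRing.Theory.
Local Open Scope ring_scope.

(** * Quadratic forms as upper triangular matrices *)

(** A hyperplane is a quadratic form in three variables up to scalar, seen as a linear functional on
    symmetric matrices. Evaluating a form [a] at A M A^T is evaluating [cact A a] at M
    ([pairing_cact]), and the four classes of conics are stable under [cact] and under scaling
    ([conic_invariant]). Hence L may be replaced by the representative line, on which a form
    vanishes exactly when its coefficients at X0 X1, X1^2 and X1 X2 agree. The hyperplanes through L
    are then the nonzero quadruples (a, b, c, t) modulo the q - 1 nonzero scalars, so each entry of
    [OD4] is a number of quadruples divided by q - 1 ([card_hyperplanes]).

    Double lines are the q^2 - 1 nonzero quadruples with t = b = 0. The conic is non-singular when t
    (t (a + b + c) + b^2) is nonzero, which happens for (q - 1) q^2 (q - 1) quadruples. For the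
    remaining members, [split_member] and [split_memberI] turn a factorization into a root s of s^2
    + s = v. If v is an Artin-Schreier value the root is in F and the lines are real. Otherwise the
    two roots s and s + 1 lie in E and are exchanged by Frobenius ([artin_schreier_root]), so the
    lines are conjugate.

    [card_singular_members] counts the members with v in an arbitrary set S. It is used for the
    Artin-Schreier set and for its complement, both of size q/2; only the former contains 0, the
    value of v at t = a = 0 for every c. This accounts for the difference q between the second and
    third entries. *)

Lemma sum_ord3 (V : nmodType) (f : 'I_3 -> V) :
  \sum_i f i = f 0 + f 1 + f 2%:R.
Proof.
rewrite !big_ord_recl big_ord0 addr0 addrA.
by congr (f _ + f _ + f _); apply/val_inj.
Qed.

Section Fold.
Variable R : comNzRingType.
Implicit Types A B C M N a : 'M[R]_3.

Definition triu a : 'M[R]_3 := \matrix_(i, j) if (i <= j)%N then a i j else 0.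

(* The upper triangular matrix of the quadratic form x |-> x B x^T. *)
Definition fold B : 'M[R]_3 :=
  \matrix_(i, j) if (i < j)%N then B i j + B j i
                 else if i == j then B i j else 0.

Definition pairing B M : R := \sum_i \sum_j B i j * M i j.

(* The form a after the substitution x |-> x A^T. *)
Definition cact A a : 'M[R]_3 := fold (A^T *m triu a *m A).

Lemma pairing_fold B M : M^T = M -> pairing (fold B) M = pairing B M.
Proof.
move=> Ms; have Msym i j : M i j = M j i by rewrite -{1}Ms mxE.
rewrite /pairing !sum_ord3 !mxE /= (Msym 1 0) (Msym 2%:R 0) (Msym 2%:R 1).
ring.
Qed.

Lemma pairingE B M : pairing B M = \tr (B^T *m M).
Proof.
rewrite /pairing /mxtrace exchange_big; apply: eq_bigr => i _.
by rewrite mxE; apply: eq_bigr => j _; rewrite mxE.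
Qed.

Lemma pairingD B M N : pairing B (M + N) = pairing B M + pairing B N.
Proof. by rewrite !pairingE mulmxDr mxtraceD. Qed.

Lemma pairingZ B c M : pairing B (c *: M) = c * pairing B M.
Proof. by rewrite !pairingE -scalemxAr mxtraceZ. Qed.

Lemma pairingZl c B M : pairing (c *: B) M = c * pairing B M.
Proof. by rewrite !pairingE linearZ -scalemxAl mxtraceZ. Qed.

Lemma pairing_conj A B M : pairing (A^T *m B *m A) M = pairing B (A *m M *m A^T).
Proof.
by rewrite !pairingE !trmx_mul trmxK -!mulmxA mxtrace_mulC -!mulmxA.
Qed.

Lemma pairing_delta B i j : pairing B (delta_mx i j) = B i j.
Proof.
rewrite /pairing (bigD1 i) //= (bigD1 j) //= mxE !eqxx mulr1 !big1 ?addr0 //.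
  by move=> k /negPf ki; rewrite big1 // => l _; rewrite mxE ki mulr0.
by move=> k /negPf kj; rewrite mxE kj andbF mulr0.
Qed.

(** Symmetric matrices, diagonal included, are in perfect duality with quadratic forms in every
    characteristic: the functionals at [delta_mx i i] and at [delta_mx i j + delta_mx j i] read off
    the coefficients. *)
Lemma foldP B C :
  (forall M, M^T = M -> pairing B M = pairing C M) -> fold B = fold C.
Proof.
move=> eqBC; apply/matrixP => i j; rewrite !mxE -val_eqE /=.
case: ltngtP => [ij|//|/val_inj ->].
  rewrite -!pairing_delta -!pairingD eqBC // linearD /= !trmx_delta.
  exact: addrC.
by rewrite -!pairing_delta eqBC // trmx_delta.
Qed.

Lemma conj_sym A M : M^T = M -> (A *m M *m A^T)^T = A *m M *m A^T.
Proof. by move=> Ms; rewrite !trmx_mul trmxK Ms mulmxA. Qed.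

Lemma fold_conj A B : fold (A^T *m fold B *m A) = fold (A^T *m B *m A).
Proof.
apply: foldP => M Ms.
by rewrite !pairing_conj pairing_fold // conj_sym.
Qed.

Lemma fold_triu a : fold (triu a) = triu a.
Proof.
apply/matrixP => i j; rewrite !mxE -val_eqE /=.
by case: ltngtP => // _; rewrite addr0.
Qed.

Lemma triu_fold B : triu (fold B) = fold B.
Proof.
apply/matrixP => i j; rewrite !mxE -val_eqE /=.
by case: ltngtP => //.
Qed.

Lemma cact1 a : cact 1%:M a = triu a.
Proof. by rewrite /cact trmx1 mul1mx mulmx1 fold_triu. Qed.

Lemma cactM A B a : cact A (cact B a) = cact (B *m A) a.
Proof. by rewrite /cact triu_fold fold_conj !trmx_mul !mulmxA. Qed.

Lemma triu_cact A a : triu (cact A a) = cact A a.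
Proof. exact: triu_fold. Qed.

Lemma foldZ c B : fold (c *: B) = c *: fold B.
Proof.
apply/matrixP => i j; rewrite !mxE; case: ifP => _; first by rewrite mulrDr.
by case: ifP => _; rewrite ?mulr0.
Qed.

Lemma triuZ c a : triu (c *: a) = c *: triu a.
Proof. by apply/matrixP => i j; rewrite !mxE; case: ifP; rewrite ?mulr0. Qed.

Lemma cactZ A c a : cact A (c *: a) = c *: cact A a.
Proof. by rewrite /cact triuZ -scalemxAr -scalemxAl foldZ. Qed.

Lemma pairing_cact A a M :
  M^T = M -> pairing (cact A a) M = pairing (triu a) (A *m M *m A^T).
Proof. by move=> Ms; rewrite pairing_fold // pairing_conj. Qed.

(** The half-discriminant: twice this value is the determinant of B + B^T for B = [triu a]. It stays
    meaningful in characteristic 2. *)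
Definition disc a : R :=
  4%:R * a 0 0 * a 1 1 * a 2%:R 2%:R + a 0 1 * a 0 2%:R * a 1 2%:R
  - a 0 0 * a 1 2%:R ^+ 2 - a 1 1 * a 0 2%:R ^+ 2 - a 2%:R 2%:R * a 0 1 ^+ 2.

Lemma det_mx33 A : \det A =
  A 0 0 * (A 1 1 * A 2%:R 2%:R - A 1 2%:R * A 2%:R 1)
  - A 0 1 * (A 1 0 * A 2%:R 2%:R - A 1 2%:R * A 2%:R 0)
  + A 0 2%:R * (A 1 0 * A 2%:R 1 - A 1 1 * A 2%:R 0).
Proof.
have sum2 (f : 'I_2 -> R) : \sum_i f i = f 0 + f 1.
  by rewrite !big_ord_recl big_ord0 addr0; congr (f _ + f _); apply/val_inj.
have l00 : lift (0 : 'I_3) (0 : 'I_2) = 1 by apply/val_inj.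
have l01 : lift (0 : 'I_3) (1 : 'I_2) = 2%:R by apply/val_inj.
have l10 : lift (1 : 'I_3) (0 : 'I_2) = 0 by apply/val_inj.
have l11 : lift (1 : 'I_3) (1 : 'I_2) = 2%:R by apply/val_inj.
have l20 : lift (2%:R : 'I_3) (0 : 'I_2) = 0 by apply/val_inj.
have l21 : lift (2%:R : 'I_3) (1 : 'I_2) = 1 by apply/val_inj.
have k00 : lift (0 : 'I_2) (0 : 'I_1) = 1 by apply/val_inj.
have k10 : lift (1 : 'I_2) (0 : 'I_1) = 0 by apply/val_inj.
rewrite (expand_det_row _ 0) sum_ord3 /cofactor.
rewrite !(expand_det_row _ (0 : 'I_2)) !sum2 /cofactor !det_mx11.
rewrite !mxE /= ?(l00, l01, l10, l11, l20, l21, k00, k10).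
rewrite !expr0 !expr1 ?sqrrN ?expr1n.
ring.
Qed.

Lemma disc_cact A a : disc (cact A a) = \det A ^+ 2 * disc a.
Proof.
rewrite /disc /cact det_mx33 !mxE !sum_ord3 /= !mxE !sum_ord3 /= !mxE /=.
ring.
Qed.
End Fold.

(** * Quadratic forms as polynomials, and the classes of conics in matrix terms *)

Section Biform.
Variable R : comNzRingType.
Implicit Types A B C M a : 'M[R]_3.

Definition biform B : {mpoly R[3]} := \sum_i \sum_j B i j *: ('X_i * 'X_j).

Lemma biform_fold B : biform (fold B) = biform B.
Proof.
rewrite /biform !sum_ord3 !mxE /= !scalerDl !scale0r.
rewrite (mulrC 'X_1 'X_0) (mulrC 'X_(2%:R) 'X_0) (mulrC 'X_(2%:R) 'X_1).
by rewrite -!mul_mpolyC; ring.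
Qed.

Lemma mnm_pair_inj (n : nat) (i j k l : 'I_n) : (i <= j)%N -> (k <= l)%N ->
  (U_(k) + U_(l))%MM = (U_(i) + U_(j))%MM -> k = i /\ l = j.
Proof.
move=> ij kl e; have [eki|nki] := eqVneq k i.
  by split=> //; apply/eqP; rewrite -eq_mnm1 -(eqm_add2l U_(i)) -e eki.
have eli : l = i.
  have /mnmP/(_ i) := e; rewrite !mnmDE !mnm1E eqxx (negPf nki) add0n.
  by case: eqP.
have ekj : k = j.
  by apply/eqP; rewrite -eq_mnm1 -(eqm_add2l U_(i)) -e eli addmC.
have eij : i = j by apply/val_inj/anti_leq; rewrite ij -eli -ekj.
by rewrite ekj eli eij.
Qed.

(** The monomials X_i X_j with i <= j are distinct ([mnm_pair_inj]), so a polynomial of degree 2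
    determines its folded matrix. *)
Lemma mcoeff_biform B (i j : 'I_3) : (i <= j)%N ->
  (biform B)@_(U_(i) + U_(j)) = fold B i j.
Proof.
move=> ij; rewrite -biform_fold -[fold B]triu_fold /biform raddf_sum /=.
rewrite (bigD1 i) //= [X in _ + X]big1 ?addr0; last first.
  move=> k /eqP ki; rewrite raddf_sum big1 //= => l _.
  rewrite mcoeffZ mxE -mpolyXD mcoeffX.
  case: ifP => [kl|]; last by rewrite mul0r.
  case: eqP => [e|]; last by rewrite mulr0.
  by case: ki; case: (mnm_pair_inj ij kl e).
rewrite raddf_sum (bigD1 j) //= [X in _ + X]big1 ?addr0; last first.
  move=> l /eqP lj; rewrite mcoeffZ mxE -mpolyXD mcoeffX.
  case: ifP => [il|]; last by rewrite mul0r.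
  case: eqP => [e|]; last by rewrite mulr0.
  by case: lj; case: (mnm_pair_inj ij il e).
by rewrite mcoeffZ -mpolyXD mcoeffX eqxx mulr1.
Qed.

Lemma biformP B C : biform B = biform C <-> fold B = fold C.
Proof.
split=> [e|e]; last by rewrite -biform_fold e biform_fold.
rewrite -(triu_fold B) -(triu_fold C); apply/matrixP => i j.
rewrite mxE [RHS]mxE; case: ifP => // ij.
by rewrite -!mcoeff_biform // e.
Qed.

Lemma biformZ c B : biform (c *: B) = c *: biform B.
Proof.
rewrite scaler_sumr; apply: eq_bigr => i _; rewrite scaler_sumr.
by apply: eq_bigr => j _; rewrite mxE scalerA.
Qed.

Lemma lformM (l m : 'rV[R]_3) : lform l * lform m = biform (l^T *m m).
Proof.
rewrite /lform mulr_suml; apply: eq_bigr => i _; rewrite mulr_sumr.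
apply: eq_bigr => j _; rewrite mxE big_ord1 mxE.
by rewrite -scalerAl -scalerAr scalerA.
Qed.

End Biform.

Lemma map_biform (R S : comNzRingType) (f : {rmorphism R -> S}) (B : 'M[R]_3) :
  map_mpoly f (biform B) = biform (map_mx f B).
Proof.
apply/mpolyP => m; rewrite mcoeff_map_mpoly !raddf_sum; apply: eq_bigr => i _.
rewrite !raddf_sum; apply: eq_bigr => j _ /=.
by rewrite !mcoeffZ -!mpolyXD !mcoeffX rmorphM rmorph_nat mxE.
Qed.

Section Classes.
Variable F : finFieldType.
Implicit Types (a A : 'M[F]_3).

Lemma qformE a : qform a = biform (triu a).
Proof.
apply: eq_bigr => i _; rewrite big_mkcond; apply: eq_bigr => j _.
by rewrite mxE; case: ifP => // _; rewrite scale0r.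
Qed.

Lemma qform_eq a B : (qform a == biform B) = (triu a == fold B).
Proof.
by rewrite qformE; apply/eqP/eqP=> [/biformP|e]; last apply/biformP;
   rewrite fold_triu.
Qed.

Lemma qform_eq0 a : (qform a == 0) = (triu a == 0).
Proof.
have fold0 : fold (0 : 'M[F]_3) = 0.
  by rewrite -[0 in LHS](scale0r 0) foldZ scale0r.
have <- : biform (0 : 'M[F]_3) = 0.
  by rewrite -[0 in LHS](scale0r 0) biformZ scale0r.
by rewrite qform_eq fold0.
Qed.

Lemma double_lineP a :
  reflect (triu a != 0 /\ exists c : F, exists l : 'rV_3,
             triu a = c *: fold (l^T *m l))
          (double_line a).
Proof.
rewrite /double_line qform_eq0.
apply: (iffP andP) => -[a0 b]; split=> //.
  have /existsP[c /existsP[l]] := b.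
  rewrite expr2 lformM -biformZ qform_eq foldZ => /eqP e.
  by exists c, l.
have [c [l e]] := b; apply/existsP; exists c; apply/existsP; exists l.
by rewrite expr2 lformM -biformZ qform_eq foldZ e.
Qed.

Lemma real_line_pairP a :
  reflect (exists l m : 'rV_3, ~~ proportional l m /\ triu a = fold (l^T *m m))
          (real_line_pair a).
Proof.
apply: (iffP existsP) => -[l].
  case/existsP=> m /andP[lm]; rewrite lformM qform_eq => /eqP e.
  by exists l, m.
case=> m [lm e]; exists l; apply/existsP; exists m.
by rewrite lm lformM qform_eq e eqxx.
Qed.

Variables (E : finFieldType) (iota : {rmorphism F -> E}).

Lemma imaginary_line_pairP a :
  reflect (triu a != 0 /\ exists c : F, exists l : 'rV[E]_3,
             ~~ proportional l (map_mx (fun x : E => x ^+ #|F|) l) /\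
             map_mx iota (triu a) =
               iota c *: fold (l^T *m map_mx (fun x : E => x ^+ #|F|) l))
          (imaginary_line_pair iota a).
Proof.
have key (c : F) (l m : 'rV[E]_3) :
  (map_mpoly iota (qform a) == iota c *: (lform l * lform m)) =
  (map_mx iota (triu a) == iota c *: fold (l^T *m m)).
  rewrite qformE map_biform lformM -biformZ -foldZ.
  have ut : fold (map_mx iota (triu a)) = map_mx iota (triu a).
    have <- : triu (map_mx iota a) = map_mx iota (triu a).
      by apply/matrixP => i j; rewrite !mxE; case: ifP => // _; rewrite rmorph0.
    exact: fold_triu.
  by apply/eqP/eqP=> [/biformP|e]; last apply/biformP; rewrite ut.
rewrite /imaginary_line_pair qform_eq0; apply: (iffP andP) => -[a0 h]; split=> //.
  have /existsP[c /existsP[l /andP[h1]]] := h.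
  by rewrite key => /eqP h2; exists c, l.
have [c [l [h1 h2]]] := h; apply/existsP; exists c; apply/existsP; exists l.
by rewrite h1 /= key h2.
Qed.

End Classes.

(** * Coordinate changes and hyperplanes *)

Lemma triu_triu (R : comNzRingType) (a : 'M[R]_3) : triu (triu a) = triu a.
Proof. by rewrite -[triu a]fold_triu triu_fold. Qed.

Lemma proportionalMr (F : finFieldType) (A : 'M[F]_3) (l m : 'rV[F]_3) :
  A \in unitmx -> proportional (l *m A) (m *m A) = proportional l m.
Proof.
move=> Au.
have inj : injective (fun l : 'rV_3 => l *m A) := can_inj (mulmxK Au).
rewrite /proportional; congr (_ || _);
  by apply: eq_existsb => c; rewrite scalemxAl (inj_eq inj).
Qed.

Lemma proportionalZl (F : finFieldType) (c : F) (l m : 'rV[F]_3) :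
  c != 0 -> proportional (c *: l) m -> proportional l m.
Proof.
move=> c0 /orP[] /existsP[d /eqP e]; apply/orP; [left|right]; apply/existsP.
  by exists (c^-1 * d); rewrite -scalerA -e scalerA mulVf ?scale1r.
by exists (d * c); rewrite -scalerA e.
Qed.

(** This gives that a product of two non-proportional linear forms is nonzero. If l_i is nonzero,
    the coefficient at X_i^2 forces m_i = 0, and then the one at X_i X_j is l_i m_j. *)
Lemma proportional_fold0 (F : finFieldType) (l m : 'rV[F]_3) :
  fold (l^T *m m) = 0 -> proportional l m.
Proof.
move=> /matrixP e; have [->|/rV0Pn[i li]] := eqVneq l 0.
  by apply/orP; left; apply/existsP; exists 0; rewrite scale0r.
have mi : m 0 i = 0.
  have /eqP := e i i; rewrite !mxE ltnn eqxx big_ord1 !mxE mulf_eq0 (negPf li).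
  by move/eqP.
suff -> : m = 0.
  by apply/orP; right; apply/existsP; exists 0; rewrite scale0r.
apply/rowP => j; rewrite !mxE; apply/eqP.
have [->|nij] := eqVneq j i; first by rewrite mi.
rewrite -(mulrI_eq0 _ (mulfI li)).
have [ij|ji] := ltnP i j.
  by have := e i j; rewrite !mxE ij !big_ord1 !mxE mi mulr0 addr0 => ->.
have {}ji : (j < i)%N by rewrite ltn_neqAle ji val_eqE nij.
by have := e j i; rewrite !mxE ji !big_ord1 !mxE mi mulr0 add0r => ->.
Qed.

Lemma pnat_card_finField (F : finFieldType) p :
  p \in [pchar F] -> p.-nat #|F|.
Proof. by move=> pF; rewrite -cardsT; apply: pprimeChar_pgroup pF. Qed.

Lemma frobeniusD (F E : finFieldType) (iota : {rmorphism F -> E}) (x y : E) :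
  (x + y) ^+ #|F| = x ^+ #|F| + y ^+ #|F|.
Proof.
have [p pr_p pF] := finPcharP F; apply: exprDn_pchar.
apply: sub_in_pnat (pnat_card_finField pF) => r _ /eqP ->.
by rewrite (fmorph_pchar iota).
Qed.

Section Invariance.
Variable F : finFieldType.
Implicit Types (a b A M : 'M[F]_3) (P : pred 'M[F]_3).

Definition conic_invariant P :=
  [/\ forall a, P a -> triu a != 0,
      forall A a, A \in unitmx -> P (cact A a) = P a
    & forall c a, c != 0 -> P (c *: a) = P a].

(** One implication suffices for each equivalence, by applying it to the inverse matrix or scalar.
    Undoing a substitution returns only [triu a], hence the second hypothesis. *)
Lemma conic_invariantI P :
  (forall a, P a -> triu a != 0) ->
  (forall a b, triu a = triu b -> P a -> P b) ->
  (forall A a, A \in unitmx -> P a -> P (cact A a)) ->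
  (forall c a, c != 0 -> P a -> P (c *: a)) -> conic_invariant P.
Proof.
move=> P0 Pt PA Pc; split=> // [A a Au|c a c0]; apply/idP/idP=> [h|]; try by auto.
  apply: (Pt (cact A^-1 (cact A a))); last by apply: PA; rewrite ?unitmx_inv.
  by rewrite cactM mulmxV // cact1 triu_triu.
by rewrite -[a](scalerK c0); apply: Pc; rewrite ?invr_eq0.
Qed.

Lemma cact_neq0 A a : A \in unitmx -> triu a != 0 -> cact A a != 0.
Proof.
move=> Au; apply: contra_neq => e.
by rewrite -(cact1 a) -(mulmxV Au) -cactM e -[0 in LHS](scale0r 0) cactZ scale0r.
Qed.

Lemma double_line_invariant : conic_invariant (@double_line F).
Proof.
apply: conic_invariantI => [a|a b e|A a Au|c a c0] /double_lineP[a0 [d [l h]]].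
- exact: a0.
- by apply/double_lineP; rewrite -e; split=> //; exists d, l.
- apply/double_lineP; rewrite triu_cact; split; first exact: cact_neq0.
  exists d, (l *m A); rewrite /cact h -foldZ fold_conj -foldZ; congr fold.
  by rewrite trmx_mul -scalemxAr -scalemxAl !mulmxA.
- apply/double_lineP; rewrite triuZ scaler_eq0 (negPf c0); split=> //.
  by exists (c * d), l; rewrite h scalerA.
Qed.

Lemma real_line_pair_invariant : conic_invariant (@real_line_pair F).
Proof.
apply: conic_invariantI => [a|a b e|A a Au|c a c0] /real_line_pairP[l [m [lm h]]].
- rewrite h; apply: contraNneq lm => e.
  exact: proportional_fold0.
- by apply/real_line_pairP; exists l, m; rewrite -e.
- apply/real_line_pairP; exists (l *m A), (m *m A).
  rewrite proportionalMr // triu_cact /cact h fold_conj; split=> //; congr fold.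
  by rewrite trmx_mul !mulmxA.
- apply/real_line_pairP; exists (c *: l), m; split.
    by apply: contra lm; apply: proportionalZl.
  by rewrite triuZ h linearZ -scalemxAl foldZ.
Qed.

Lemma nonsingular_conic_invariant : conic_invariant (@nonsingular_conic F).
Proof.
have nsE a : nonsingular_conic a = (disc a != 0) by [].
have disc_triu a : disc (triu a) = disc a by rewrite /disc !mxE.
apply: conic_invariantI => [a|a b e|A a Au|c a c0]; rewrite !nsE.
- apply: contra_neq => e; rewrite -disc_triu e /disc !mxE; ring.
- by rewrite -(disc_triu a) -(disc_triu b) e.
- rewrite disc_cact => d0.
  by rewrite mulf_neq0 // expf_neq0 //; rewrite unitmxE unitfE in Au.
- move=> d0; have -> : disc (c *: a) = c ^+ 3 * disc a.
    by rewrite /disc !mxE; ring.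
  by rewrite mulf_neq0 // expf_neq0.
Qed.

Variables (E : finFieldType) (iota : {rmorphism F -> E}).

Lemma imaginary_line_pair_invariant : conic_invariant (imaginary_line_pair iota).
Proof.
apply: conic_invariantI => [a|a b e|A a Au|c a c0]
  /imaginary_line_pairP[a0 [d [l [lm h]]]].
- exact: a0.
- by apply/imaginary_line_pairP; rewrite -e; split=> //; exists d, l.
- apply/imaginary_line_pairP; rewrite triu_cact; split; first exact: cact_neq0.
  (* Conjugation commutes with substitutions defined over F, so conjugate lines go to conjugate
     lines. *)
  have frobM : map_mx (fun x : E => x ^+ #|F|) (l *m map_mx iota A) =
     map_mx (fun x : E => x ^+ #|F|) l *m map_mx iota A.
    apply/rowP => j; rewrite !mxE !sum_ord3 !(frobeniusD iota) !exprMn !mxE.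
    by rewrite -!rmorphXn /= !expf_card.
  have map_fold B : map_mx iota (fold B) = fold (map_mx iota B).
    apply/matrixP => i j; rewrite !mxE; case: ifP => _; first by rewrite rmorphD.
    by case: ifP => _; rewrite ?rmorph0.
  exists d, (l *m map_mx iota A); rewrite frobM proportionalMr ?map_unitmx //.
  split; first exact: lm.
  rewrite /cact map_fold !map_mxM -map_trmx h -foldZ fold_conj -foldZ; congr fold.
  by rewrite trmx_mul -scalemxAr -scalemxAl !mulmxA.
- apply/imaginary_line_pairP; rewrite triuZ scaler_eq0 (negPf c0); split=> //.
  by exists (c * d), l; rewrite map_mxZ h scalerA rmorphM.
Qed.

End Invariance.

(** * Hyperplanes as point sets, and those that contain the line *)

Section Hyperplanes.
Variable F : finFieldType.
Implicit Types (a b A M : 'M[F]_3) (P : pred 'M[F]_3).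

Lemma mem_pt M : M \in pt M.
Proof. by apply/imsetP; exists 1; rewrite ?scale1r // inE oner_eq0. Qed.

Lemma K_point_pt A M : K_point A (pt M) = pt (A *m M *m A^T).
Proof.
rewrite /K_point /pt -imset_comp; apply: eq_imset => c /=.
by rewrite -scalemxAr -scalemxAl.
Qed.

Lemma mem_hyperplane a M :
  (pt M \in hyperplane a) =
  [&& M^T == M, M != 0 & pairing (triu a) M == 0].
Proof.
have pairE N : pairing (triu a) N =
    \sum_(i < 3) \sum_(j < 3 | (i <= j)%N) a i j * N i j.
  apply: eq_bigr => i _; rewrite [RHS]big_mkcond; apply: eq_bigr => j _.
  by rewrite mxE; case: ifP => // _; rewrite mul0r.
apply/imsetP/idP => [[N]|h]; last by exists M; rewrite // inE -pairE.
rewrite inE -pairE => /and3P[/eqP Ns N0 /eqP aN] /esym e.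
have := mem_pt N; rewrite e => /imsetP[c]; rewrite inE => c0 eN.
have -> : M = c^-1 *: N by rewrite eN scalerK.
rewrite linearZ /= Ns eqxx scaler_eq0 invr_eq0 (negPf c0) N0 /=.
by rewrite pairingZ aN mulr0.
Qed.

Lemma eq_hyperplane a b c :
  c != 0 -> triu a = c *: triu b -> hyperplane a = hyperplane b.
Proof.
move=> c0 e; have eq_mem M : (pt M \in hyperplane a) = (pt M \in hyperplane b).
  rewrite !mem_hyperplane e pairingZl.
  by rewrite mulf_eq0 (negPf c0).
by apply/setP => p; apply/idP/idP => h; have /imsetP[M _ eM] := h;
  move: h; rewrite eM eq_mem.
Qed.

(** Two functionals with the same kernel are proportional. With b(M0) = 1, every M - b(M) M0 lies in
    the kernel of b, hence in that of a, so a = a(M0) b. *)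
Lemma hyperplane_inj a b : triu a != 0 -> triu b != 0 ->
  hyperplane a = hyperplane b -> exists2 c, c != 0 & triu a = c *: triu b.
Proof.
move=> a0 b0 e.
have [M0 M0s bM0] : exists2 M0, M0^T = M0 & pairing (triu b) M0 = 1.
  have [i [j [ij bij]]] : exists i j : 'I_3, (i <= j)%N /\ b i j != 0.
    move/matrix0Pn: b0 => [i [j]]; rewrite mxE; case: ifP => [ij ?|_ /eqP//].
    by exists i, j.
  have [eij|nij] := eqVneq i j.
    exists ((b i j)^-1 *: delta_mx i j); rewrite ?linearZ /= ?trmx_delta ?eij //.
    by rewrite pairingZ pairing_delta mxE leqnn mulVf // -{1}eij.
  exists ((b i j)^-1 *: (delta_mx i j + delta_mx j i)).
    by rewrite linearZ linearD /= !trmx_delta addrC.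
  rewrite pairingZ pairingD !pairing_delta !mxE ij leqNgt ltn_neqAle ij val_eqE nij /=.
  by rewrite addr0 mulVf.
pose f := pairing (triu a) M0.
have eq_ab : triu a = f *: triu b.
  rewrite -(fold_triu a) -(fold_triu b) -foldZ; apply: foldP => M Ms.
  rewrite pairingZl.
  pose N := M - pairing (triu b) M *: M0.
  have Ns : N^T = N by rewrite linearB linearZ /= Ms M0s.
  suff : pairing (triu a) N = 0.
    rewrite /N -scaleNr pairingD pairingZ => /eqP.
    by rewrite mulNr subr_eq0 => /eqP ->; rewrite mulrC.
  (* The zero matrix is not a projective point, so it is treated apart. *)
  have [->|N0] := eqVneq N 0; first by rewrite -(scale0r 0) pairingZ mul0r.
  have : pt N \in hyperplane b.
    rewrite mem_hyperplane Ns N0 eqxx /N -scaleNr pairingD pairingZ bM0 mulr1.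
    by rewrite subrr /=.
  by rewrite -e mem_hyperplane => /and3P[_ _ /eqP].
exists f => //; apply: contra_neq a0 => f0.
by rewrite eq_ab f0 scale0r.
Qed.

(* In characteristic 2 the hyperplanes containing line_o12_3 are those given  *)
(* by the matrices pencil x (see sub_hyperplane).                             *)
Definition pencil (x : F * F * F * F) : 'M[F]_3 :=
  let: (a, b, c, t) := x in triu (symmx a t b t t c).

Lemma pencilE U : triu U = U -> U 0 1 = U 1 1 -> U 1 2%:R = U 1 1 ->
  U = pencil (U 0 0, U 0 2%:R, U 2%:R 2%:R, U 1 1).
Proof.
move=> Ut e1 e2; rewrite -[LHS]Ut; apply/matrixP => i j; rewrite mxE [RHS]mxE.
case: ifP => //; move: i j => -[[|[|[|//]]] i3] [[|[|[|//]]] j3] //= _;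
  rewrite mxE /=; first [by congr (U _ _); apply/val_inj
    | by rewrite -e1; congr (U _ _); apply/val_inj
    | by rewrite -e2; congr (U _ _); apply/val_inj].
Qed.

Lemma symmx_sym y0 y1 y2 y3 y4 y5 :
  (symmx y0 y1 y2 y3 y4 y5)^T = symmx y0 y1 y2 y3 y4 y5 :> 'M[F]_3.
Proof.
by apply/matrixP => -[[|[|[|//]]] ?] [[|[|[|//]]] ?]; rewrite !mxE.
Qed.

Lemma pairing_symmx a y0 y1 y2 y3 y4 y5 :
  pairing (triu a) (symmx y0 y1 y2 y3 y4 y5) =
  a 0 0 * y0 + a 0 1 * y1 + a 0 2%:R * y2 + a 1 1 * y3 + a 1 2%:R * y4
  + a 2%:R 2%:R * y5.
Proof. by rewrite /pairing !sum_ord3 !mxE /=; ring. Qed.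

Hypothesis F2 : 1 + 1 = 0 :> F.

Lemma addxx (x : F) : x + x = 0.
Proof. by rewrite -[x]mulr1 -mulrDr F2 mulr0. Qed.

Lemma oppxx (x : F) : - x = x.
Proof. by apply/eqP; rewrite eq_sym -addr_eq0 addxx. Qed.

Lemma sub_hyperplane A a : A \in unitmx ->
  (K_line A (line_o12_3 F) \subset hyperplane a) = [exists x, cact A a == pencil x].
Proof.
move=> Au; pose S (x y : F) := symmx 0 x 0 (x + y) y 0.
have memS x y : (x, y) != (0, 0) ->
    (K_point A (pt (S x y)) \in hyperplane a) =
    (pairing (cact A a) (S x y) == 0).
  move=> xy0; rewrite K_point_pt mem_hyperplane conj_sym ?symmx_sym // eqxx /=.
  rewrite -pairing_cact ?symmx_sym //.
  suff -> : A *m S x y *m A^T != 0 by [].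
  apply: contra_neq xy0 => e0.
  have {e0} : S x y = 0.
    have := congr1 (fun M => invmx A *m M *m invmx A^T) e0.
    by rewrite mulmx0 mul0mx -(mulmxA A) mulKmx // mulmxK ?unitmx_tr.
  by move=> /matrixP e; have := e 0 1; have := e 1 2%:R; rewrite !mxE /= => -> ->.
have pS x y : pairing (cact A a) (S x y) =
    cact A a 0 1 * x + cact A a 1 1 * (x + y) + cact A a 1 2%:R * y.
  by rewrite -triu_cact pairing_symmx !triu_cact; ring.
apply/subsetP/existsP => [sub | [[[[u v] w] t] /eqP e] p0 /imsetP[p + ->]].
  have on x y : (x, y) != (0, 0) ->
      cact A a 0 1 * x + cact A a 1 1 * (x + y) + cact A a 1 2%:R * y = 0.
    move=> xy0; rewrite -pS; apply/eqP; rewrite -memS //; apply: sub.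
    by apply/imsetP; exists (pt (S x y)) => //; apply/imsetP; exists (x, y).
  (* The points (1, 0) and (0, 1) span the line and give the two equations. *)
  have e1 : cact A a 0 1 = cact A a 1 1.
    have n10 : (1, 0) != (0, 0) :> F * F by rewrite xpair_eqE oner_eq0.
    have /eqP := on 1 0 n10.
    by rewrite addr0 mulr0 addr0 !mulr1 addr_eq0 oppxx => /eqP.
  have e2 : cact A a 1 2%:R = cact A a 1 1.
    have n01 : (0, 1) != (0, 0) :> F * F by rewrite xpair_eqE oner_eq0 andbF.
    have /eqP := on 0 1 n01.
    by rewrite add0r mulr0 add0r !mulr1 addr_eq0 oppxx => /eqP.
  exists (cact A a 0 0, cact A a 0 2%:R, cact A a 2%:R 2%:R, cact A a 1 1).
  by apply/eqP/pencilE; rewrite ?triu_cact.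
move=> /imsetP[[x y] xy0 ->]; rewrite memS // pS e !mxE /=.
by rewrite mulrDr addrA !addxx add0r addxx.
Qed.

Lemma pencil_inj : injective pencil.
Proof.
move=> [[[a b] c] t] [[[a' b'] c'] t'] /matrixP e.
have := e 0 0; have := e 0 1; have := e 0 2%:R; have := e 2%:R 2%:R.
by rewrite !mxE /= => -> -> -> ->.
Qed.

Lemma pencilZ (k a b c t : F) :
  pencil (k * a, k * b, k * c, k * t) = k *: pencil (a, b, c, t).
Proof.
rewrite /pencil -triuZ; congr triu.
by apply/matrixP => -[[|[|[|//]]] ?] [[|[|[|//]]] ?]; rewrite !mxE.
Qed.

Lemma triu_pencil x : triu (pencil x) = pencil x.
Proof. by case: x => [[[a b] c] t]; apply: triu_triu. Qed.

(** Each hyperplane of the class through the line comes from exactly q - 1 quadruples, namely the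
    nonzero multiples of one of them: these are the fibres of [f]. *)
Lemma card_hyperplanes P A : conic_invariant P -> A \in unitmx ->
  (#|[set H in [set hyperplane a | a in P]
       | K_line A (line_o12_3 F) \subset H]| * #|F|.-1)%N =
  #|[set x | P (pencil x)]|.
Proof.
move=> [P0 PA Pc] Au; have Aiu : A^-1 \in unitmx by rewrite unitmx_inv.
pose D := [set x | P (pencil x)]; pose f x := hyperplane (cact A^-1 (pencil x)).
have cactK x : cact A (cact A^-1 (pencil x)) = pencil x.
  by rewrite cactM mulVmx // cact1 triu_pencil.
have -> : [set H in [set hyperplane a | a in P]
       | K_line A (line_o12_3 F) \subset H] = f @: D.
  apply/setP => H; rewrite inE; apply/andP/imsetP => [[]|[x]].
    move=> /imsetP[a Pa ->]; rewrite sub_hyperplane // => /existsP[x /eqP e].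
    exists x; first by rewrite inE -e PA.
    rewrite /f -e cactM mulmxV // cact1.
    by apply/esym/(eq_hyperplane (oner_neq0 F)); rewrite triu_triu scale1r.
  rewrite inE => Px ->; split; last first.
    by rewrite sub_hyperplane //; apply/existsP; exists x; rewrite cactK.
  by apply/imsetP; exists (cact A^-1 (pencil x)) => //; rewrite -topredE /= PA.
rewrite -/D -[RHS]sum1_card (partition_big_imset f) /=.
rewrite (eq_bigr (fun=> #|F|.-1)) ?sum_nat_const // => H /imsetP[[[[a b] c] t]].
rewrite inE => Px ->; rewrite sum1dep_card.
have nz : pencil (a, b, c, t) != 0 by rewrite -triu_pencil P0.
have nzf y : P (pencil y) -> triu (cact A^-1 (pencil y)) != 0.
  by move=> Py; apply: P0; rewrite PA.
pose g (k : F) := (k * a, k * b, k * c, k * t).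
have -> : [set x in D | f x == f (a, b, c, t)] = g @: [set~ 0].
  apply/setP => y; rewrite !inE; apply/andP/imsetP => [[Py /eqP efy]|[k]].
    have [| |k k0] := hyperplane_inj _ _ efy.
    - exact: nzf.
    - exact: nzf.
    rewrite !triu_cact => e; exists k; first by rewrite !inE.
    by apply: pencil_inj; rewrite pencilZ -(cactK (a, b, c, t)) -cactZ -e cactK.
  rewrite !inE => k0 ->; split; first by rewrite pencilZ (Pc _ _ k0).
  apply/eqP; rewrite /f pencilZ cactZ; apply: (eq_hyperplane k0).
  exact: triuZ.
rewrite card_imset ?cardsC1 // => k k' e.
have /eqP : k *: pencil (a, b, c, t) = k' *: pencil (a, b, c, t).
  by rewrite -!pencilZ -/(g k) e.
by rewrite -subr_eq0 -scalerBl scaler_eq0 (negPf nz) orbF subr_eq0 => /eqP.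
Qed.
End Hyperplanes.

(** * The Artin-Schreier map in characteristic 2 *)

Section ArtinSchreier.
Variable F : finFieldType.
Hypothesis F2 : 1 + 1 = 0 :> F.

Definition artin_schreier : {set F} := [set x ^+ 2 + x | x : F].

Lemma sqrD2 (x y : F) : (x + y) ^+ 2 = x ^+ 2 + y ^+ 2.
Proof. by rewrite sqrrD mulr2n addxx // addr0. Qed.

Lemma artin_schreierD v w : v \in artin_schreier -> w \in artin_schreier ->
  v + w \in artin_schreier.
Proof.
move=> /imsetP[x _ ->] /imsetP[y _ ->]; apply/imsetP; exists (x + y) => //.
by rewrite sqrD2; ring.
Qed.

Lemma artin_schreier_eq (x y : F) :
  (x ^+ 2 + x == y ^+ 2 + y) = (x == y) || (x == y + 1).
Proof.
rewrite -subr_eq0 -(subr_eq0 x) -(subr_eq0 x (y + 1)) -mulf_eq0.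
(* [ring] does not know that 2 = 0, so the discrepancy between the two sides is exhibited as w +
   w. *)
pose w := x - y ^+ 2 - y + x * y.
have -> : x ^+ 2 + x - (y ^+ 2 + y) = (x - y) * (x - (y + 1)) + (w + w).
  by rewrite /w; ring.
by rewrite addxx // addr0.
Qed.

(** The map x |-> x^2 + x is two-to-one, its fibres being the pairs {y, y + 1}. *)
Lemma card_artin_schreier : (#|artin_schreier| * 2 = #|F|)%N.
Proof.
rewrite -[RHS]cardsT -[RHS]sum1_card.
rewrite (partition_big_imset (fun x : F => x ^+ 2 + x)) /=.
rewrite (eq_bigr (fun=> 2%N)) => [|_ /imsetP[y _ ->]].
  rewrite sum_nat_const; congr (_ * _)%N; apply: eq_card => v.
  by apply/imsetP/imsetP => -[x _ ->]; exists x.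
rewrite sum1dep_card.
have -> : [set x in setT | x ^+ 2 + x == y ^+ 2 + y] = [set y; y + 1].
  by apply/setP => x; rewrite !inE artin_schreier_eq.
by rewrite cards2 -subr_eq0 opprD addrA subrr add0r oppr_eq0 oner_eq0.
Qed.

(** The set is an additive subgroup with q/2 elements, so its complement is the single coset of
    v. *)
Lemma artin_schreier_index2 v w : v \notin artin_schreier ->
  w \notin artin_schreier -> v + w \in artin_schreier.
Proof.
move=> vS wS; pose T := [set v + s | s in artin_schreier].
have cT : #|T| = #|artin_schreier| by rewrite card_imset //; apply: addrI.
have vvs s : v + (v + s) = s by rewrite addrA addxx // add0r.
have ST : T = ~: artin_schreier.
  apply/eqP; rewrite eqEcard; apply/andP; split.
    apply/subsetP => _ /imsetP[s sS ->]; rewrite inE; apply: contra vS => vsS.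
    by rewrite -[v](addrK s) oppxx // artin_schreierD.
  by rewrite cT cardsCs setCK -card_artin_schreier muln2 -addnn addnK.
have : w \in T by rewrite ST inE.
by case/imsetP => s sS ->; rewrite vvs.
Qed.

Lemma artin_schreier0 : 0 \in artin_schreier.
Proof. by apply/imsetP; exists 0; rewrite // expr0n addr0. Qed.

End ArtinSchreier.

(** * Artin-Schreier roots in the quadratic extension *)

Section QuadraticExtension.
Variables (F E : finFieldType) (iota : {rmorphism F -> E}).
Hypothesis (F2 : 1 + 1 = 0 :> F) (cardE : #|E| = (#|F| ^ 2)%N).

Lemma char2_ext : 1 + 1 = 0 :> E.
Proof. by rewrite -(rmorph1 iota) -rmorphD F2 rmorph0. Qed.

(** The polynomial X^q - X has at most q roots, and the image of F already supplies q. *)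
Lemma frobenius_fixed (x : E) : x ^+ #|F| = x -> x \in codom iota.
Proof.
move=> fx; pose A := [set y : E | y ^+ #|F| == y].
have F1 : (1 < #|F|)%N by exact: (finNzRing_gt1 F).
have leA : (#|A| <= #|F|)%N.
  pose p : {poly E} := 'X^#|F| - 'X.
  have sp : size p = #|F|.+1.
    by rewrite size_polyDl ?size_polyXn // size_polyN size_polyX.
  have p0 : p != 0 by rewrite -size_poly_eq0 sp.
  rewrite -ltnS -sp fintype.cardE; apply: max_poly_roots p0 _ (enum_uniq _).
  by apply/allP => y; rewrite mem_enum inE rootE !hornerE => /eqP ->; rewrite subrr.
have sub : [set iota z | z : F] \subset A.
  by apply/subsetP => _ /imsetP[z _ ->]; rewrite inE -rmorphXn /= expf_card.
have eqA : [set iota z | z : F] = A.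
  by apply/eqP; rewrite eqEcard sub card_imset //; apply: fmorph_inj.
have : x \in A by rewrite inE fx.
by rewrite -eqA => /imsetP[z _ ->]; apply: codom_f.
Qed.

Lemma artin_schreier_root v : v \notin artin_schreier F ->
  exists2 x : E, x ^+ 2 + x = iota v & x ^+ #|F| = x + 1.
Proof.
have E2 := char2_ext; have F1 : (1 < #|F|)%N by exact: (finNzRing_gt1 F).
(* Any root works: Frobenius permutes the two roots x and x + 1, and fixing x would put it in F and
   v in the Artin-Schreier set. *)
move=> vS; suff [x ex] : exists x : E, x ^+ 2 + x = iota v.
  exists x => //; have : x ^+ #|F| ^+ 2 + x ^+ #|F| == x ^+ 2 + x.
    by rewrite exprAC -(frobeniusD iota) ex -rmorphXn /= expf_card.
  rewrite artin_schreier_eq // => /orP[/eqP fx|/eqP //].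
  have /codomP[y ey] := frobenius_fixed fx.
  case/negP: vS; apply/imsetP; exists y => //; apply: (fmorph_inj iota).
  by rewrite -ex ey rmorphD rmorphXn.
have [w wF] : exists w : E, w ^+ #|F| != w.
  apply/existsP; rewrite -negb_forall; apply/negP => /forallP allF.
  suff : (#|E| <= #|F|)%N by rewrite cardE leqNgt -{1}[#|F|]expn1 ltn_exp2l.
  rewrite -(card_codom (fmorph_inj iota)).
  by apply/subset_leq_card/subsetP => x _; apply: frobenius_fixed; apply/eqP.
have frobK (x : E) : x ^+ #|F| ^+ #|F| = x by rewrite -exprM mulnn -cardE expf_card.
(* Dividing w by its nonzero trace s gives u with u^q = u + 1. Then N = u^2 + u is an element of F
   outside the Artin-Schreier set, so v + N = y^2 + y for some y in F, and u + y is the required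
   root. *)
pose s := w + w ^+ #|F|; pose u := w / s.
have s0 : s != 0 by rewrite addr_eq0 oppxx // eq_sym.
have fs : s ^+ #|F| = s by rewrite /s (frobeniusD iota) frobK addrC.
have uu : u ^+ #|F| = u + 1.
  apply: (mulIf s0); rewrite mulrDl mul1r {1}/u exprMn exprVn fs !divfK //.
  by rewrite addrA addxx // add0r.
have [N eN] : exists N, u ^+ 2 + u = iota N.
  apply/codomP/frobenius_fixed; rewrite (frobeniusD iota) exprAC uu.
  by rewrite sqrD2 // expr1n addrACA E2 addr0.
have NS : N \notin artin_schreier F.
  apply/negP => /imsetP[y _ ey]; move: eN; rewrite ey rmorphD rmorphXn => /eqP.
  have fy : iota y ^+ #|F| = iota y by rewrite -rmorphXn /= expf_card.
  rewrite artin_schreier_eq // => /orP[]/eqP e; move/eqP: uu;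
    rewrite e ?(frobeniusD iota) ?expr1n fy.
    by rewrite -subr_eq0 opprD addrA subrr add0r oppr_eq0 oner_eq0.
  by rewrite -subr_eq0 opprD addrA subrr add0r oppr_eq0 oner_eq0.
have /imsetP[y _ ey] := artin_schreier_index2 F2 vS NS.
exists (u + iota y); rewrite sqrD2 // addrACA eN -rmorphXn -rmorphD -ey -rmorphD.
by rewrite addrCA addxx // addr0.
Qed.
End QuadraticExtension.

(** * The conics through the representative line *)

Section Splitting.
Variable F : finFieldType.
Hypothesis F2 : 1 + 1 = 0 :> F.
Implicit Types (l m : 'rV[F]_3) (x : F * F * F * F).

(** Singular but not a double line: when t = 0 the conic is always singular and b = 0 is excluded;
    when t is nonzero the other factor of the half-discriminant must vanish. *)
Definition singular_member (x : F * F * F * F) :=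
  let: (a, b, c, t) := x in
  if t == 0 then b != 0 else t * (a + b + c) + b ^+ 2 == 0.

Definition splitting_param (x : F * F * F * F) : F :=
  let: (a, b, c, t) := x in if t == 0 then a * c / b ^+ 2 else a / t.

Definition row3 (x y z : F) : 'rV[F]_3 := \row_i nth 0 [:: x; y; z] i.

(** For t = 0 the conic is a times the product of X0 + (b/a) s X2 and the same form with s + 1 for
    s; otherwise it is t times the product of s X0 + X1 + (s + b/t) X2 and the same form with s +
    1. *)
Definition splitting_form (x : F * F * F * F) (s : F) : 'rV[F]_3 :=
  let: (a, b, c, t) := x in
  if t == 0 then row3 1 0 (b / a * s) else row3 s 1 (s + b / t).

(** On a [singular_member] this vanishes only when t = a = 0, where the formula of [splitting_form]
    breaks down. *)
Definition splitting_lead (x : F * F * F * F) : F :=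
  let: (a, b, c, t) := x in if t == 0 then a else t.

Lemma fold_outerE l m a b c t : fold (l^T *m m) = pencil (a, b, c, t) <->
  [/\ l 0 0 * m 0 0 = a, l 0 0 * m 0 2%:R + l 0 2%:R * m 0 0 = b,
      l 0 2%:R * m 0 2%:R = c, l 0 1 * m 0 1 = t
    & l 0 0 * m 0 1 + l 0 1 * m 0 0 = t /\
      l 0 1 * m 0 2%:R + l 0 2%:R * m 0 1 = t].
Proof.
have outer j k : (l^T *m m) j k = l 0 j * m 0 k by rewrite mxE big_ord1 mxE.
split=> [/matrixP e|[e1 e2 e3 e4 [e5 e6]]].
  have := (e 0 0, e 0 2%:R, e 2%:R 2%:R, e 1 1, e 0 1, e 1 2%:R).
  by rewrite !mxE /= !big_ord1 !mxE => -[[[[[-> ->] ->] ->] ->] ->].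
have d : triu (fold (l^T *m m)) 1 1 = t.
  by rewrite !mxE /= big_ord1 !mxE.
rewrite -triu_fold [LHS]pencilE ?triu_triu //.
- by rewrite !mxE /= !big_ord1 !mxE e1 e2 e3 e4.
- by rewrite d !mxE /= !big_ord1 !mxE e5.
- by rewrite d !mxE /= !big_ord1 !mxE e6.
Qed.

Lemma proportional_eq l m i : l 0 i = 1 -> m 0 i = 1 -> proportional l m -> l = m.
Proof.
move=> li mi /orP[]/existsP[c /eqP e]; move: (congr1 (fun u : 'rV_3 => u 0 i) e).
  by rewrite mxE li mi mulr1 => c1; rewrite e -c1 scale1r.
by rewrite mxE li mi mulr1 => c1; rewrite e -c1 scale1r.
Qed.

Lemma rowP3 l m : l 0 0 = m 0 0 -> l 0 1 = m 0 1 -> l 0 2%:R = m 0 2%:R -> l = m.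
Proof.
move=> h0 h1 h2; apply/rowP => -[[|[|[|//]]] i3].
- by move: h0; congr (l _ _ = m _ _); apply/val_inj.
- by move: h1; congr (l _ _ = m _ _); apply/val_inj.
- by move: h2; congr (l _ _ = m _ _); apply/val_inj.
Qed.

(** The values s and s' are the two roots of X^2 + X = v: their sum is 1 by the mixed coefficients
    and their product is v by the square ones. Exchanging l and m exchanges s and s', which is why
    both are given. *)
Lemma split_member l m x : ~~ proportional l m ->
  fold (l^T *m m) = pencil x ->
  let: (a, b, c, t) := x in
  let s := if t == 0 then l 0 0 * m 0 2%:R / b else l 0 0 / l 0 1 in
  let s' := if t == 0 then l 0 2%:R * m 0 0 / b else m 0 0 / m 0 1 in
  [/\ singular_member x, splitting_param x = s ^+ 2 + s & s' = s + 1].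
Proof.
case: x => [[[a b] c] t] lm /fold_outerE[].
have propI k : m 0 0 = k * l 0 0 -> m 0 1 = k * l 0 1 ->
    m 0 2%:R = k * l 0 2%:R -> proportional l m.
  move=> h0 h1 h2; apply/orP; right; apply/existsP; exists k.
  by apply/eqP/rowP3; rewrite mxE.
have l_neq0 : ~ (l 0 0 = 0 /\ l 0 1 = 0 /\ l 0 2%:R = 0).
  move=> [h0 [h1 h2]]; case/negP: lm; apply/orP; left; apply/existsP; exists 0.
  by apply/eqP/rowP3; rewrite mxE mul0r.
have m_neq0 : ~ (m 0 0 = 0 /\ m 0 1 = 0 /\ m 0 2%:R = 0).
  by move=> [h0 [h1 h2]]; case/negP: lm; apply: (propI 0); rewrite mul0r.
move: propI l_neq0 m_neq0.
set l0 := l 0 0; set l1 := l 0 1; set l2 := l 0 2%:R.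
set m0 := m 0 0; set m1 := m 0 1; set m2 := m 0 2%:R.
move=> propI l_neq0 m_neq0 ea eb ec et [e1 e2] /=.
have cancel (u v w : F) : u + v = w -> v = w + u.
  by move=> <-; rewrite addrAC addxx // add0r.
have [tz|t0] := eqVneq t 0; last first.
  have [l10 m10] : l1 != 0 /\ m1 != 0.
    by apply/andP; rewrite -negb_or -mulf_eq0 et.
  have half u v : u * m1 + l1 * v = t -> v / m1 = u / l1 + 1.
    move=> e; rewrite addrC; apply: cancel.
    transitivity ((u * m1 + l1 * v) / (l1 * m1)); last by rewrite e et divff.
    by field; rewrite l10 m10.
  have s's : m0 / m1 = l0 / l1 + 1 by apply: half.
  have u'u : m2 / m1 = l2 / l1 + 1 by apply: half; rewrite addrC.
  move: s's u'u; set s := l0 / l1; set u := l2 / l1 => s's u'u.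
  have el0 : l0 = s * l1 by rewrite divfK.
  have el2 : l2 = u * l1 by rewrite divfK.
  have em0 : m0 = (s + 1) * m1 by rewrite -s's divfK.
  have em2 : m2 = (u + 1) * m1 by rewrite -u'u divfK.
  rewrite -ea -eb -ec -et el0 el2 em0 em2; split=> //.
    (* Again a quantity that is zero only because 2 = 0, written as w + w. *)
    pose w := (l1 * m1) ^+ 2 * (s + u + s ^+ 2 + u ^+ 2 + s * u + s * u
                 + (s + s) * u * (s + u) + (s + s) * s * u ^+ 2).
    by apply/eqP; rewrite -[RHS](addxx F2 w) /w; ring.
  by field; rewrite l10 m10.
  by rewrite mulfK.
rewrite tz in et e1 e2.
(* If just one of l1, m1 vanished, the coefficients at X0 X1 and X1 X2 would kill the whole form to
   which it belongs. *)
have [l1z m1z] : l1 = 0 /\ m1 = 0.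
  have [l1z|l1n] := eqVneq l1 0; have [m1z|m1n] := eqVneq m1 0 => //.
  - case: l_neq0; move: e1 e2; rewrite l1z !mul0r addr0 add0r => /eqP + /eqP.
    by rewrite !mulf_eq0 (negPf m1n) !orbF => /eqP -> /eqP ->.
  - case: m_neq0; move: e1 e2; rewrite m1z !mulr0 addr0 add0r => /eqP + /eqP.
    by rewrite !mulf_eq0 (negPf l1n) => /eqP -> /eqP ->.
  - by move/eqP: et; rewrite mulf_eq0 (negPf l1n) (negPf m1n).
(* If b = 0, then l0 m2 = l2 m0 in characteristic 2, and the two forms would be proportional. *)
have b0 : b != 0.
  apply: contraNneq lm => b0; rewrite b0 in eb.
  have e : l2 * m0 = l0 * m2 by rewrite (cancel _ _ _ eb) add0r.
  have [l0z|l0n] := eqVneq l0 0; last first.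
    apply: (propI (m0 / l0)); rewrite -/l0 -/l1 -/l2 -/m0 -/m1 -/m2 ?l1z ?m1z.
    - by rewrite divfK.
    - by rewrite mulr0.
    - by apply: (mulfI l0n); rewrite -e; field.
  have [l2z|l2n] := eqVneq l2 0; first by case: l_neq0.
  apply: (propI (m2 / l2)); rewrite -/l0 -/l1 -/l2 -/m0 -/m1 -/m2 ?l1z ?m1z ?l0z.
  - by apply/eqP; rewrite mulr0 -(mulrI_eq0 _ (mulfI l2n)) e l0z mul0r.
  - by rewrite mulr0.
  - by rewrite divfK.
have s's : l2 * m0 / b = l0 * m2 / b + 1.
  by rewrite (cancel _ _ _ eb) mulrDl mulfV // addrC.
split=> //.
rewrite -[X in _ = _ + X]mulr1 expr2 -mulrDr -s's -ea -ec.
by field.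
Qed.

Lemma split_memberI x s : singular_member x ->
  splitting_param x = s ^+ 2 + s -> splitting_lead x != 0 ->
  pencil x =
    splitting_lead x *:
      fold ((splitting_form x s)^T *m splitting_form x (s + 1)) /\
  ~~ proportional (splitting_form x s) (splitting_form x (s + 1)).
Proof.
case: x => [[[a b] c] t] sing ps lead0; split; last first.
  have s1 : (s == s + 1) = false.
    by rewrite -subr_eq0 opprD addrA subrr add0r oppr_eq0 oner_eq0.
  move: sing lead0; rewrite /=; case: eqVneq => [_ b0 a0|t0 _ _]; apply/negP => h.
    have e : row3 1 0 (b / a * s) = row3 1 0 (b / a * (s + 1)).
      by apply: (proportional_eq (i := 0)) h; rewrite mxE.
    have /eqP := congr1 (fun u : 'rV_3 => u 0 2%:R) e; rewrite !mxE /=.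
    by rewrite (inj_eq (mulfI _)) ?s1 // mulf_neq0 ?invr_eq0.
  have e : row3 s 1 (s + b / t) = row3 (s + 1) 1 (s + 1 + b / t).
    by apply: (proportional_eq (i := 1)) h; rewrite mxE.
  by have /eqP := congr1 (fun u : 'rV_3 => u 0 0) e; rewrite !mxE /= s1.
have dbl (u v w : F) : u = v + (w + w) -> u = v by rewrite addxx // addr0.
rewrite -foldZ scalemxAl -linearZ; apply/esym/fold_outerE.
move: sing ps lead0; rewrite /=; case: eqVneq => [-> b0 ps a0|t0 sing ps _].
  rewrite !mxE /= !(mulr0, mul0r, mulr1, addr0); split=> //.
    by apply: (dbl _ _ (b * s)); field.
  transitivity (b ^+ 2 / a * (s ^+ 2 + s)); first by field.
  by rewrite -ps; field; rewrite a0 b0.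
have ea : a = t * (s ^+ 2 + s) by rewrite -ps mulrC divfK.
have ec : c = a + b + b ^+ 2 / t.
  apply/eqP; rewrite -subr_eq0 oppxx // -(mulrI_eq0 _ (mulfI t0)).
  apply/eqP; rewrite -(eqP sing); field.
  by rewrite t0.
rewrite !mxE /= !(mulr0, mul0r, mulr1, addr0); split=> //.
- by rewrite ea; ring.
- by apply: (dbl _ _ (t * (s ^+ 2 + s) + s * b)); field.
- by rewrite ec ea; apply: (dbl _ _ (s * b)); field.
split; first by apply: (dbl _ _ (t * s)); ring.
by apply: (dbl _ _ (t * s + b)); field.
Qed.

End Splitting.

(** * Classes of the pencil decided over F *)

Section PencilClasses.
Variable F : finFieldType.
Hypothesis F2 : 1 + 1 = 0 :> F.

Lemma pencil_eq0 (x : F * F * F * F) : pencil x = 0 -> x = (0, 0, 0, 0).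
Proof.
move=> e; apply: pencil_inj; rewrite e; case: x {e} => [[[a b] c] t].
by rewrite -[X in (X, _, _, _)](mul0r a) -[X in (_, X, _, _)](mul0r b)
  -[X in (_, _, X, _)](mul0r c) -[X in (_, _, _, X)](mul0r t) pencilZ scale0r.
Qed.

Lemma singular_member_neq0 (x : F * F * F * F) :
  singular_member x -> triu (pencil x) != 0.
Proof.
move=> sx; rewrite triu_pencil; apply/eqP => /pencil_eq0 ex.
by rewrite ex /= !eqxx in sx.
Qed.

Lemma splitting_lead_neq0 (x : F * F * F * F) : singular_member x ->
  splitting_param x != 0 -> splitting_lead x != 0.
Proof.
case: x => [[[a b] c] t] /=; case: (eqVneq t 0) => // _ _.
by apply: contra_neq => ->; rewrite !mul0r.
Qed.

Lemma real_line_pair_pencil (x : F * F * F * F) : real_line_pair (pencil x) =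
  singular_member x && (splitting_param x \in artin_schreier F).
Proof.
apply/real_line_pairP/andP => [[l [m [lm]]]|[sx /imsetP[s _ es]]].
  rewrite triu_pencil => /esym/(split_member F2 lm).
  case: x => [[[a b] c] t] [sx px _]; split=> //.
  by apply/imsetP; eexists; last exact: px.
have [lead0|lead_n0] := eqVneq (splitting_lead x) 0; last first.
  have [e np] := split_memberI F2 sx es lead_n0.
  exists (splitting_lead x *: splitting_form x s), (splitting_form x (s + 1)).
  split; first by apply: contra np; apply: proportionalZl.
  by rewrite triu_pencil e linearZ -scalemxAl foldZ.
(* Here t = a = 0, and the conic is X2 (b X0 + c X2). *)
case: x sx lead0 {es} => [[[a b] c] t] sx lead0.
have [t0 b0 a0] : [/\ t = 0, b != 0 & a = 0].
  by move: sx lead0 => /=; case: eqVneq => [//|t0 _ et]; rewrite et eqxx in t0.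
rewrite t0 a0 triu_pencil; exists (row3 0 0 1), (row3 b 0 c); split.
  apply/negP => /orP[]/existsP[k /eqP/rowP e]; move: (e 0) (e 2%:R);
    rewrite !mxE /= ?mulr0.
    move=> /esym/eqP; rewrite mulf_eq0 (negPf b0) orbF => /eqP ->.
    by rewrite mul0r => /eqP; rewrite oner_eq0.
  by move=> e0; rewrite e0 eqxx in b0.
apply/esym/fold_outerE.
by rewrite !mxE /= !(mul0r, mulr0, mul1r, addr0, add0r).
Qed.

Lemma double_line_pencil (a b c t : F) : double_line (pencil (a, b, c, t)) =
  [&& t == 0, b == 0 & (a, c) != (0, 0)].
Proof.
apply/double_lineP/and3P => [|[/eqP -> /eqP -> ac]].
  rewrite triu_pencil => -[n0 [d [l e]]]; move: (e).
  rewrite -foldZ scalemxAl -linearZ /=.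
  move=> /esym/fold_outerE[_ eb _ _ [et _]].
  have b0 : b = 0 by rewrite -eb !mxE mulrAC addxx.
  have t0 : t = 0 by rewrite -et !mxE mulrAC addxx.
  rewrite b0 t0 !eqxx; split=> //; apply: contra_neq n0 => -[-> ->].
  have := pencilZ 0 0 0 0 (0 : F); rewrite !mul0r scale0r => <-.
  by rewrite b0 t0.
(* Squaring is onto: the Artin-Schreier set has q/2 elements, and u^(q/2) squares to u^q = u. *)
have sqrt (u : F) : exists v, v ^+ 2 = u.
  exists (u ^+ #|artin_schreier F|).
  by rewrite -exprM card_artin_schreier // expf_card.
rewrite triu_pencil; split.
  apply: contraNneq ac => /pencil_eq0[-> ->]; exact: eqxx.
have [u eu] := sqrt a; have [v ev] := sqrt c.
exists 1, (row3 u 0 v); rewrite scale1r; apply/esym/fold_outerE.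
rewrite !mxE /= !(mul0r, mulr0, addr0, add0r) -!expr2 eu ev (mulrC v).
by rewrite addxx.
Qed.

Lemma nonsingular_conic_pencil (a b c t : F) :
  nonsingular_conic (pencil (a, b, c, t)) =
  (t != 0) && (t * (a + b + c) + b ^+ 2 != 0).
Proof.
rewrite -negb_or -mulf_eq0 /nonsingular_conic !mxE /=.
pose w := a * t * c + a * t * c - a * t ^+ 2 - t * b ^+ 2 - c * t ^+ 2.
congr (_ != 0); rewrite -[RHS]addr0 -(addxx F2 w) /w; ring.
Qed.

End PencilClasses.

(** * Pairs of conjugate imaginary lines in the pencil *)

Section ImaginaryPencil.
Variables (F E : finFieldType) (iota : {rmorphism F -> E}).
Hypothesis (F2 : 1 + 1 = 0 :> F) (cardE : #|E| = (#|F| ^ 2)%N).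

Definition ext_member (x : F * F * F * F) : E * E * E * E :=
  let: (a, b, c, t) := x in (iota a, iota b, iota c, iota t).

Lemma map_pencil x : map_mx iota (pencil x) = pencil (ext_member x).
Proof.
case: x => [[[a b] c] t]; apply/matrixP => i j; rewrite !mxE.
case: ifP => _; last exact: rmorph0.
by move: i j => -[[|[|[|//]]] ?] [[|[|[|//]]] ?] /=; rewrite ?rmorph0.
Qed.

Lemma singular_member_ext x : singular_member (ext_member x) = singular_member x.
Proof.
case: x => [[[a b] c] t] /=; rewrite !fmorph_eq0; case: ifP => // _.
by rewrite -rmorphXn -!rmorphD -rmorphM -rmorphD fmorph_eq0.
Qed.

Lemma splitting_param_ext x :
  splitting_param (ext_member x) = iota (splitting_param x).
Proof.
case: x => [[[a b] c] t] /=; rewrite !fmorph_eq0; case: ifP => // _.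
  by rewrite -rmorphXn -rmorphM fmorph_div.
by rewrite fmorph_div.
Qed.

Lemma splitting_lead_ext x :
  splitting_lead (ext_member x) = iota (splitting_lead x).
Proof. by case: x => [[[a b] c] t] /=; rewrite !fmorph_eq0; case: ifP. Qed.

Let conj (l : 'rV[E]_3) := map_mx (fun y : E => y ^+ #|F|) l.

Lemma frobenius_iota (y : F) : iota y ^+ #|F| = iota y.
Proof. by rewrite -rmorphXn /= expf_card. Qed.

Lemma splitting_form_ext x s : s ^+ #|F| = s + 1 ->
  conj (splitting_form (ext_member x) s) =
  splitting_form (ext_member x) (s + 1).
Proof.
have q0 : 0 ^+ #|F| = 0 :> E by rewrite -(rmorph0 iota) frobenius_iota.
move=> es; case: x => [[[a b] c] t] /=; rewrite !fmorph_eq0; case: ifP => _;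
  apply: rowP3; rewrite !mxE /= ?expr1n ?q0 //.
  by rewrite exprMn es -fmorph_div frobenius_iota.
by rewrite (frobeniusD iota) es -fmorph_div frobenius_iota.
Qed.

Lemma imaginary_line_pair_pencil x : imaginary_line_pair iota (pencil x) =
  singular_member x && (splitting_param x \notin artin_schreier F).
Proof.
have E2 := char2_ext iota F2.
apply/imaginary_line_pairP/andP => [[n0 [d [l [lm]]]]|[sx vS]]; last first.
  split; first exact: singular_member_neq0.
  have v0 : splitting_param x != 0.
    (* The degenerate case with zero leading coefficient has v = 0, an Artin-Schreier value. *)
    by apply: contraNneq vS => ->; apply: artin_schreier0.
  have [s es fs] := artin_schreier_root iota F2 cardE vS.
  have ld0 : splitting_lead (ext_member x) != 0.
    by rewrite splitting_lead_ext fmorph_eq0 splitting_lead_neq0.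
  rewrite -splitting_param_ext in es.
  have sxE : singular_member (ext_member x) by rewrite singular_member_ext.
  have [e np] := split_memberI E2 sxE (esym es) ld0.
  exists (splitting_lead x), (splitting_form (ext_member x) s).
  rewrite -/(conj _) splitting_form_ext //; split=> //.
  by rewrite triu_pencil map_pencil e splitting_lead_ext.
rewrite triu_pencil map_pencil => e.
have d0 : iota d != 0.
  apply: contraNneq n0 => d0; rewrite triu_pencil; apply/eqP.
  apply: (map_mx_inj (f := iota)); rewrite map_pencil e d0 scale0r.
  by rewrite map_mx0.
(* The scalar is absorbed into the first factor, so that [split_member] applies over E. *)
have np : ~~ proportional (iota d *: l) (conj l).
  by apply: contra lm; apply: proportionalZl.
have ef : fold ((iota d *: l)^T *m conj l) = pencil (ext_member x).
  by rewrite e linearZ -scalemxAl foldZ.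
have frobK (y : E) : y ^+ #|F| ^+ #|F| = y by rewrite -exprM mulnn -cardE expf_card.
case: x e ef n0 => [[[a b] c] t] _ ef _; rewrite -singular_member_ext.
have [sx px es] := split_member E2 np ef; split; first exact: sx.
apply/negP => /imsetP[y _ ey].
move: px es; rewrite -[LHS]/(splitting_param (ext_member (a, b, c, t))).
rewrite splitting_param_ext ey rmorphD rmorphXn.
set s := (X in _ = X ^+ 2 + _); set s' := (X in X = s + 1) => px es.
(* Frobenius exchanges the conjugate factors, so s^q = s' = s + 1. But v = y^2 + y with y in F would
   make s equal to y or y + 1, fixed by Frobenius. *)
have fs : s ^+ #|F| = s'.
  rewrite /s /s' !mxE; case: ifP => _; rewrite !exprMn exprVn ?exprMn.
    by rewrite !frobK !frobenius_iota; ring.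
  by rewrite !frobenius_iota -mulf_div divff // mul1r.
have fy := frobenius_iota y; move: (esym px) => /eqP.
have s1 (z : E) : z == z + 1 = false.
  by rewrite -subr_eq0 opprD addrA subrr add0r oppr_eq0 oner_eq0.
rewrite artin_schreier_eq // => /orP[]/eqP e; move/eqP: fs;
  by rewrite es e ?(frobeniusD iota) ?expr1n fy s1.
Qed.

End ImaginaryPencil.

(** * Counting quadruples and conclusion *)

Section Counting.
Variable F : finFieldType.
Local Notation q := #|F|.

Lemma card_quadruples (P : pred (F * F * F * F)) :
  #|[set x | P x]| = (\sum_t \sum_b \sum_a \sum_c P (a, b, c, t))%N.
Proof.
rewrite -sum1dep_card big_mkcond /= !pair_bigA /=.
pose h (p : F * F * F * F) := (p.1.2, p.1.1.2, p.2, p.1.1.1).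
rewrite (reindex h) /=.
  by apply: eq_bigr => -[[[t b] a] c] _; case: (P _).
apply: onW_bij; exists (fun x => (x.2, x.1.1.2, x.1.1.1, x.1.2)).
  by case=> [[[? ?] ?] ?].
by case=> [[[? ?] ?] ?].
Qed.

Lemma sum_field_neq0 (G : F -> nat) n : (forall x, x != 0 -> G x = n) ->
  (\sum_x G x = G 0%R + q.-1 * n)%N.
Proof.
move=> Gn; rewrite (bigD1 0) //=; congr (_ + _)%N.
rewrite (eq_bigr (fun=> n)) // sum_nat_const; congr (_ * n)%N.
by rewrite -(cardC1 (0 : F)); apply: eq_card => x; rewrite !inE.
Qed.

Lemma sum_affine (S : {set F}) (P : pred F) k d :
  k != 0 -> (forall x, P x = (k * x + d \in S)) -> (\sum_x P x = #|S|)%N.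
Proof.
move=> k0 PE; rewrite -[RHS]sum1_card [RHS]big_mkcond.
have bij : bijective (fun x => k * x + d).
  exists (fun y => (y - d) / k) => x; first by rewrite addrK mulrC mulKf.
  by rewrite mulrC divfK // subrK.
rewrite [RHS](reindex _ (onW_bij _ bij)).
by apply: eq_bigr => x _; rewrite PE; case: ifP.
Qed.

Lemma card_double_members :
  #|[set x : F * F * F * F | let: (a, b, c, t) := x in
      [&& t == 0, b == 0 & (a, c) != (0, 0)]]| = (q.-1 * (q + 1))%N.
Proof.
have q0 : (0 < q)%N by apply/card_gt0P; exists 0.
rewrite card_quadruples (sum_field_neq0 (n := 0)) => [|t t0]; last first.
  by rewrite (negPf t0) big1 // => b _; rewrite big1 // => a _; rewrite big1.
rewrite (sum_field_neq0 (n := 0)) => [|b b0]; last first.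
  by rewrite big1 // => a _; rewrite big1 // => c _; rewrite (negPf b0) andbF.
rewrite !eqxx /= (sum_field_neq0 (n := q)) => [|a a0]; last first.
  by under eq_bigr do rewrite xpair_eqE (negPf a0); rewrite sum_nat_const muln1.
rewrite (sum_affine (S := [set~ 0]) (k := 1) (d := 0)) ?oner_eq0 //.
  by rewrite cardsC1 !muln0 !addn0 mulnDr muln1 addnC.
by move=> c; rewrite !inE mul1r addr0 xpair_eqE eqxx.
Qed.

Lemma card_nonsingular_members :
  #|[set x : F * F * F * F | let: (a, b, c, t) := x in
      (t != 0) && (t * (a + b + c) + b ^+ 2 != 0)]| = (q.-1 * (q ^ 3 - q ^ 2))%N.
Proof.
rewrite card_quadruples (sum_field_neq0 (n := q * (q * q.-1))) => [|t t0].
  rewrite [X in (X + _)%N]big1 => [|b _].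
    have : (0 < q)%N by apply/card_gt0P; exists 0.
    by case: #|F| => // p _ /=; nia.
  by rewrite big1 // => a _; rewrite big1 // => c _; rewrite eqxx.
rewrite t0 -sum_nat_const; apply: eq_bigr => b _.
rewrite -sum_nat_const; apply: eq_bigr => a _.
rewrite (sum_affine (S := [set~ 0]) (k := t) (d := t * (a + b) + b ^+ 2)) //.
  by rewrite cardsC1.
by move=> c; rewrite !inE; congr (_ != 0); ring.
Qed.

(** For t nonzero, b is free, a/t ranges over S, and c is determined. For t = 0 and b nonzero, a = 0
    gives v = 0 for all q values of c, while a nonzero makes v a bijective function of c. *)
Lemma card_singular_members (S : {set F}) :
  #|[set x : F * F * F * F | singular_member x && (splitting_param x \in S)]| =
  (q.-1 * ((0%R \in S) * q + q.-1 * #|S|) + q.-1 * (q * #|S|))%N.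
Proof.
rewrite card_quadruples (sum_field_neq0 (n := q * #|S|)) => [|t t0]; last first.
  rewrite -sum_nat_const; apply: eq_bigr => b _; rewrite /= (negPf t0).
  rewrite -(sum_affine (P := fun a => a / t \in S) (k := t^-1) (d := 0)).
  - apply: eq_bigr => a _; case aS: (a / t \in S) => /=.
      rewrite (sum_affine (S := [set 0]) (k := t) (d := t * (a + b) + b ^+ 2)) //.
        by rewrite cards1.
      by move=> c; rewrite andbT !inE; congr (_ == 0); ring.
    by rewrite big1 // => c _; rewrite andbF.
  - by rewrite invr_eq0.
  - by move=> a; rewrite addr0 mulrC.
congr (_ + _)%N; rewrite /= eqxx.
rewrite (sum_field_neq0 (n := (0%R \in S) * q + q.-1 * #|S|)) => [|b b0].
  by rewrite eqxx big1 // => a _; rewrite big1.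
rewrite b0 /= (sum_field_neq0 (n := #|S|)) => [|a a0].
  congr (_ + _)%N; under eq_bigr do rewrite !mul0r.
  by rewrite sum_nat_const mulnC.
apply: (sum_affine (k := a / b ^+ 2) (d := 0)) => [|c].
  by rewrite mulf_neq0 ?invr_eq0 ?expf_neq0.
by rewrite addr0 mulrAC.
Qed.

End Counting.

Lemma finField_char2 (F : finFieldType) : ~~ odd #|F| -> 1 + 1 = 0 :> F.
Proof.
move=> q_even; have [p pr_p pF] := finPcharP F.
have : p.-nat 2 by apply: pnat_dvd (pnat_card_finField pF); rewrite dvdn2.
rewrite pnatE // => /eqP ep; rewrite -ep in pF.
exact: pcharf0 pF.
Qed.

Local Close Scope ring_scope.

Theorem lemma4p10 (q : nat) (q_even : ~~ odd q)
    (F : finFieldType) (cardF : #|F| = q)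
    (E : finFieldType) (iota : {rmorphism F -> E}) (cardE : #|E| = (q ^ 2)%N)
    (L : {set {set 'M[F]_3}}) (L_o12_3 : L \in o12_3 F) :
  OD4 iota L =
    [:: (q + 1)%N; (q ^ 2 + q %/ 2)%N; (q ^ 2 - q %/ 2)%N; (q ^ 3 - q ^ 2)%N].
Proof.
subst q.
have F2 := finField_char2 q_even.
have q1 : (1 < #|F|)%N := finNzRing_gt1 F.
have cS := card_artin_schreier F2.
have half : (#|F| %/ 2 = #|artin_schreier F|)%N by rewrite -cS mulnK.
have [A Au ->] := imsetP L_o12_3; rewrite inE in Au.
have count P n : conic_invariant P ->
    #|[set x | P (pencil x)]| = (#|F|.-1 * n)%N ->
    #|[set H in [set hyperplane a | a in P] | K_line A (line_o12_3 F) \subset H]| = n.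
  move=> invP; rewrite -(card_hyperplanes F2 invP Au) mulnC => /eqP.
  by rewrite eqn_pmul2l -?subn1 ?subn_gt0 // => /eqP.
rewrite /OD4 half; congr [:: _; _; _; _]; apply: count.
- exact: double_line_invariant.
- rewrite -card_double_members; apply: eq_card => -[[[a b] c] t].
  by rewrite !inE double_line_pencil.
- exact: real_line_pair_invariant.
- transitivity #|[set x | singular_member x &&
                          (splitting_param x \in artin_schreier F)]|.
    by apply: eq_card => x; rewrite !inE real_line_pair_pencil.
  (* Since 0 is in S and |S| = q/2: q + (q - 1) q/2 + q q/2 = q^2 + q/2. *)
  rewrite card_singular_members artin_schreier0 mul1n -mulnDr -cS.
  by case: #|artin_schreier F| => // p; congr (_ * _)%N; rewrite mulSn /=; nia.
- exact: imaginary_line_pair_invariant.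
- transitivity #|[set x | singular_member x &&
                          (splitting_param x \in ~: artin_schreier F)]|.
    by apply: eq_card => x; rewrite !inE imaginary_line_pair_pencil.
  (* The complement also has q/2 elements but misses 0: (q - 1) q/2 + q q/2 = q^2 - q/2. *)
  rewrite card_singular_members inE artin_schreier0 cardsCs setCK mul0n -mulnDr.
  rewrite -cS; case: #|artin_schreier F| => // p; congr (_ * _)%N.
  by rewrite mulSn /=; nia.
- exact: nonsingular_conic_invariant.
- rewrite -card_nonsingular_members; apply: eq_card => -[[[a b] c] t].
  by rewrite !inE nonsingular_conic_pencil.
Qed.
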